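(* A class of graphs has bounded shrubdepth if and only if it is distance-$\infty$ flip-flat.
   Context: Flips: for a graph $G$, partition $\mathcal{K}$ of $V(G)$ and symmetric $F\subseteq\mathcal{K}^2$, $G\oplus_{\mathcal{K}}F$ is the graph on $V(G)$ where distinct $u,v$ are adjacent iff exactly one of ''$uv\in E(G)$'' and ''$(\mathcal{K}(u),\mathcal{K}(v))\in F$'' holds; a $k$-flip uses $|\mathcal{K}|\le k$. A class $\mathcal{C}$ is distance-$\infty$ flip-flat if there exist a function $N:\mathbb{N}\to\mathbb{N}$ and a constant $k$ such that for all $m\in\mathbb{N}$, $G\in\mathcal{C}$ and $W\subseteq V(G)$ with $|W|\ge N(m)$ there exist $W_\star\subseteq W$ with $|W_\star|\ge m$ and a $k$-flip $H$ of $G$ such that no two distinct vertices of $W_\star$ lie in the same connected component of $H$. Shrubdepth (Ganian et al.): a tree-model with $m$ colors and depth $d$ of a graph $G$ is a rooted tree $T$ in which every root-to-leaf path has length exactly $d$ and whose set of leaves is $V(G)$, together with a coloring $\lambda:V(G)\to[m]$ and a set $S\subseteq[m]\times[m]\times\{1,\dots,2d\}$ (symmetric in the first two coordinates) such that distinct $u,v\in V(G)$ are adjacent iff $(\lambda(u),\lambda(v),\mathrm{dist}_T(u,v))\in S$. A class has bounded shrubdepth if there are $m,d$ such that every graph in it has a tree-model with $m$ colors and depth $d$. *)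

(* Defs.v *)
From HB Require Import structures.
From mathcomp Require Import all_boot.

Set Implicit Arguments.
Unset Strict Implicit.
Unset Printing Implicit Defensive.

(* Finite simple graphs. The vertex set is nonempty: a rooted tree always has
   a leaf, so no tree-model has an empty set of leaves. *)
Record sgraph := SGraph {
  vertex :> finType;
  adj : rel vertex;
  adj_sym : symmetric adj;
  adj_irrefl : irreflexive adj;
  vertex_gt0 : 0 < #|vertex|
}.

Definition graph_class := sgraph -> Prop.

Section Flips.
Variable G : sgraph.
Implicit Types (K : {set {set G}}) (F : {set {set G} * {set G}}).

Definition flip_adj K F : rel G := fun u v =>
  (u != v) && (adj u v (+) ((pblock K u, pblock K v) \in F)).

Definition is_kflip (k : nat) (H : rel G) : Prop :=
  exists K F,
    [/\ partition K [set: G],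
        #|K| <= k,
        F \subset setX K K,
        forall A B, ((A, B) \in F) = ((B, A) \in F)
      & H =2 flip_adj K F].

Lemma kflip_simple k H : is_kflip k H -> symmetric H /\ irreflexive H.
Proof.
case=> K [F [_ _ _ symF defH]]; split=> [u v | u]; rewrite !defH /flip_adj.
  by rewrite eq_sym adj_sym symF.
by rewrite eqxx.
Qed.

End Flips.

Definition distance_oo_flip_flat (C : graph_class) : Prop :=
  exists (N : nat -> nat) (k : nat),
    forall (m : nat) (G : sgraph) (W : {set G}),
      C G -> N m <= #|W| ->
      exists (Wstar : {set G}) (H : rel G),
        [/\ Wstar \subset W,
            m <= #|Wstar|,
            is_kflip k H
          & {in Wstar &, forall u v, u != v -> ~~ connect H u v}].

Section RootedTrees.
Variable T : sgraph.

Definition connected : Prop := forall x y : T, connect (@adj T) x y.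

(* [ucycle] also accepts the empty sequence and the back-and-forth [:: x; y]
   along an edge; genuine cycles are those of size at least 3. *)
Definition acyclic : Prop := forall p : seq T, ucycle (@adj T) p -> size p < 3.

Definition is_tree : Prop := connected /\ acyclic.

(* Length of a shortest walk; it is #|T| when there is no walk. *)
Definition dist (x y : T) : nat :=
  find (fun n => [exists p : n.-tuple T, path (@adj T) x p && (last x p == y)])
       (iota 0 #|T|).

Definition child (r x y : T) : bool := adj x y && (dist r y == (dist r x).+1).

(* Leaves of the tree rooted at r; the root is a leaf only if it is the sole
   vertex, even when it has degree 1. *)
Definition leaf (r x : T) : bool := [forall y, ~~ child r x y].

End RootedTrees.

(* The leaves are identified with the vertices of G by the map [tm_leaf]. *)
Record tree_model (m d : nat) (G : sgraph) := TreeModel {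
  tm_tree : sgraph;
  tm_root : tm_tree;
  tm_leaf : G -> tm_tree;
  tm_color : G -> 'I_m;
  tm_sig : pred ('I_m * 'I_m * nat);
  tm_treeP : is_tree tm_tree;
  tm_depth : forall p : seq tm_tree,
    path (@adj tm_tree) tm_root p -> uniq (tm_root :: p) ->
    leaf tm_root (last tm_root p) -> size p = d;
  tm_leaf_inj : injective tm_leaf;
  tm_leafP : forall t : tm_tree, leaf tm_root t <-> exists u, tm_leaf u = t;
  tm_sig_range : forall a b n, tm_sig (a, b, n) -> 1 <= n <= 2 * d;
  tm_sig_sym : forall a b n, tm_sig (a, b, n) = tm_sig (b, a, n);
  tm_adjP : forall u v : G, u != v ->
    adj u v = tm_sig (tm_color u, tm_color v, dist (tm_leaf u) (tm_leaf v))
}.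

Definition bounded_shrubdepth (C : graph_class) : Prop :=
  exists m d : nat, forall G : sgraph, C G -> inhabited (tree_model m d G).

(* Main.v *)
Require Import Defs.
From mathcomp Require Import all_boot.

(** From a tree-model of depth [d], a large set of leaves contains many leaves
    lying in distinct components of [T - x] for some node [x].  Tree distances
    between such components add up through [x], so flipping by the colors
    (label, distance to [x]) separates these leaves.

    Conversely, two [k]-flips separating the same large set [Z] have a common
    component [D] around some [z] in [Z].  The partition of the vertices by
    their neighborhood in [D], refined by adjacency to one representative per
    class, is fine enough to separate every other vertex [w] whose component
    in the unknown flip meets the same classes as [D].  Hence an arbitrary
    flip separating [Z] predicts boundedly many flips, one of which separates
    the later members of any flip-flat set starting with [Z].  If the graph
    could not be split to single vertices by boundedly many rounds of flipping
    and passing to a component, one could pick a long sequence of vertices in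
    a shrinking chain of components that survive all flips predicted from
    earlier vertices; a flip-flat subset of that sequence is a contradiction.
    The rounds of flipping form the tree-model. *)

Set Implicit Arguments.
Unset Strict Implicit.
Unset Printing Implicit Defensive.

(** * Pigeonhole principles *)

Lemma pigeonhole_imset (T Q : finType) (f : T -> Q) (A : {set T}) n :
  n * #|f @: A| < #|A| -> exists q, n < #|[set x in A | f x == q]|.
Proof.
move=> ltA; apply/existsP; apply: contraLR ltA; rewrite negb_exists -leqNgt.
move=> /forallP small; rewrite mulnC -sum_nat_const -sum1_card.
rewrite (partition_big f (mem (f @: A))) => [|x xA] /=; last exact: imset_f.
apply: leq_sum => q _; move: (small q); rewrite -leqNgt; apply: leq_trans.
by rewrite -sum1_card; apply: eq_leq; apply: eq_bigl => x; rewrite inE.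
Qed.

Lemma pigeonhole (T Q : finType) (f : T -> Q) (A : {set T}) n :
  n * #|Q| < #|A| -> exists q, n < #|[set x in A | f x == q]|.
Proof.
move=> ltA; apply: pigeonhole_imset; apply: leq_ltn_trans ltA.
by rewrite leq_mul2l max_card orbT.
Qed.

(** * Flips given by vertex colorings *)

Section ColorFlips.
Variables (G : sgraph) (C : finType).
Implicit Types (c : G -> C) (F : {ffun C * C -> bool}).

(* Conjoining both orders makes every [F] encode a symmetric relation. *)
Definition symF F (a b : C) := F (a, b) && F (b, a).

Definition cflip c F : rel G := fun u v =>
  (u != v) && (adj u v (+) symF F (c u) (c v)).

Definition comp (e : rel G) (x : G) : {set G} := [set y | connect e x y].

Lemma symFC F a b : symF F a b = symF F b a.
Proof. by rewrite /symF andbC. Qed.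

Lemma cflip_sym c F : symmetric (cflip c F).
Proof. by move=> u v; rewrite /cflip eq_sym adj_sym symFC. Qed.

Lemma connect_cflipC c F : connect_sym (cflip c F).
Proof. exact: sym_connect_sym (cflip_sym c F). Qed.

(** A pair left non-adjacent by a flip has its adjacency cancelled by the flip relation. Hence
    adjacency between components is a function of the colors. *)
Lemma cflip_far c F u v :
  ~~ connect (cflip c F) u v -> adj u v = symF F (c u) (c v).
Proof.
move=> nuv; have: ~~ cflip c F u v by apply: contra nuv; apply: connect1.
rewrite /cflip; have -> : u != v by apply: contraNneq nuv => ->.
by case: (adj u v); case: (symF _ _ _).
Qed.

Lemma comp_refl (e : rel G) x : x \in comp e x.
Proof. by rewrite inE. Qed.

Lemma cflip_comp_far c F x u v : u \in comp (cflip c F) x ->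
  v \notin comp (cflip c F) x -> adj u v = symF F (c u) (c v).
Proof.
rewrite !inE => xu; apply: contraNeq => far.
apply: contraNT far => nuv; apply/eqP/cflip_far; apply: contra nuv.
exact: connect_trans.
Qed.

Lemma comp_disjoint c F x y u : ~~ connect (cflip c F) x y ->
  u \in comp (cflip c F) x -> u \notin comp (cflip c F) y.
Proof.
rewrite !inE => nxy xu; apply: contra nxy; rewrite connect_cflipC => uy.
by apply: connect_trans xu _; rewrite connect_cflipC in uy *.
Qed.

End ColorFlips.

Lemma connect_leave (T : finType) (e : rel T) (A : {set T}) x y :
  connect e x y -> x \in A -> y \notin A ->
  exists u v, [/\ connect e x u, e u v, u \in A & v \notin A].
Proof.
case/connectP=> p; elim: p x => [|a p IHp] x /=.
  by move=> _ -> ->.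
case/andP=> exa pa ylast xA yA.
have [aA|aA] := boolP (a \in A); last by exists x, a.
have [u [v [au uv uA vA]]] := IHp a pa ylast aA yA.
by exists u, v; split=> //; apply: connect_trans (connect1 exa) au.
Qed.

(** * Flips separating the same set share a component *)

Section Uniqueness.
Variables (G : sgraph) (Q : finType).
Variables (c c' : G -> Q) (F F' : {ffun Q * Q -> bool}).
Let H := cflip c F.
Let H' := cflip c' F'.
Variable Z : {set G}.
Hypothesis sepH : {in Z &, forall u v, u != v -> ~~ connect H u v}.
Hypothesis sepH' : {in Z &, forall u v, u != v -> ~~ connect H' u v}.

(* Three bad vertices whose leaving edges carry the same colors contradict
   each other: [F] and [F'] disagree on these colors, so each cross pair must
   lie in one component of [H']. *)
Lemma few_not_subset :
  #|[set z in Z | ~~ (comp H z \subset comp H' z)]| <= 2 * #|{: Q * Q * Q * Q}|.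
Proof.
set B := [set z in Z | _]; rewrite leqNgt; apply/negP=> many.
pose edge z (xy : G * G) := [&& connect H z xy.1, H xy.1 xy.2,
  xy.1 \in comp H' z & xy.2 \notin comp H' z].
have edgeB z : z \in B -> exists xy, edge z xy.
  rewrite inE => /andP[_ /subsetPn[y yH yH']]; rewrite inE in yH.
  have [u [v [zu uv uA vA]]] := connect_leave yH (comp_refl H' z) yH'.
  by exists (u, v); apply/and4P.
pose E z := odflt (z, z) [pick xy | edge z xy].
have EP z : z \in B -> edge z (E z).
  by move=> /edgeB[xy exy]; rewrite /E; case: pickP => [//|/(_ xy)]; rewrite exy.
pose f z := (c (E z).1, c' (E z).1, c (E z).2, c' (E z).2).
have [q] := pigeonhole f many; set A := [set z in B | _].
rewrite cardE; have: uniq (enum A) by apply: enum_uniq.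
have inA z : z \in enum A -> z \in A by rewrite mem_enum.
case: (enum A) inA => [//|z1 [//|z2 [//|z3 s]]] inA /= U _.
have z1A : z1 \in A by apply: inA; rewrite !inE eqxx.
have z2A : z2 \in A by apply: inA; rewrite !inE eqxx ?orbT.
have z3A : z3 \in A by apply: inA; rewrite !inE eqxx ?orbT.
have [n12 n13 n23] : [/\ z1 != z2, z1 != z3 & z2 != z3].
  by move: U; rewrite !inE !negb_or; case/and3P=> /and3P[-> -> _] /andP[-> _].
have BZ z : z \in B -> z \in Z by rewrite inE => /andP[].
have AB z : z \in A -> z \in B by rewrite inE => /andP[].
have Af z z' : z \in A -> z' \in A -> f z = f z'.
  by rewrite !inE => /andP[_ /eqP->] /andP[_ /eqP->].
have key z z' : z \in A -> z' \in A -> z != z' -> connect H' z (E z').2.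
  move=> zA z'A nzz'; have := EP _ (AB _ zA); have := EP _ (AB _ z'A).
  case/and4P=> zx' Hx'y' x'H' y'H'; case/and4P=> zx Hxy xH' yH'.
  have [fe1 fe2 fe3 fe4] := Af _ _ zA z'A.
  have := cflip_comp_far xH' yH'.
  move: Hxy; rewrite {1}/H /cflip => /andP[_ ad] ad'.
  have nzz'H := sepH (BZ _ (AB _ zA)) (BZ _ (AB _ z'A)) nzz'.
  have zy' : (E z').2 \in comp H z'.
    by rewrite inE; apply: connect_trans (connect1 Hx'y').
  have xC : (E z).1 \in comp H z by rewrite inE.
  (* These two vertices lie in different components of [H], so [F] decides their adjacency. Were
     they also in different components of [H'], then [F'] would give the opposite value. *)
  have far : adj (E z).1 (E z').2 = symF F (c (E z).1) (c (E z').2).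
    apply: cflip_comp_far xC _; apply: comp_disjoint _ zy'.
    by rewrite connect_cflipC.
  apply: contraT => nc; have: (E z').2 \notin comp H' z by rewrite inE.
  move=> /(cflip_comp_far xH'); rewrite far.
  by move: ad; rewrite ad' fe3 fe4 => /[swap] ->; rewrite addbb.
(* In [H'], both [z1] and [z3] are joined to the end of the edge chosen for [z2]. *)
have c12 := key _ _ z1A z2A n12; have c32 := key _ _ z3A z2A.
have /negP[] := sepH' (BZ _ (AB _ z1A)) (BZ _ (AB _ z3A)) n13.
by apply: connect_trans c12 _; rewrite connect_cflipC c32 // eq_sym.
Qed.

End Uniqueness.

(** Using [few_not_subset] in both directions discards at most [2 + 2] times the number of color
    quadruples. *)
Lemma exists_common_comp (G : sgraph) (Q : finType) (c c' : G -> Q)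
    (F F' : {ffun Q * Q -> bool}) (Z : {set G}) :
  {in Z &, forall u v, u != v -> ~~ connect (cflip c F) u v} ->
  {in Z &, forall u v, u != v -> ~~ connect (cflip c' F') u v} ->
  4 * #|{: Q * Q * Q * Q}| < #|Z| ->
  exists2 z, z \in Z & comp (cflip c F) z = comp (cflip c' F') z.
Proof.
move=> sep sep' ltZ.
have b1 := few_not_subset sep sep'; have b2 := few_not_subset sep' sep.
set B1 := [set _ in _ | _] in b1; set B2 := [set _ in _ | _] in b2.
have: #|B1 :|: B2| < #|Z|.
  apply: leq_ltn_trans ltZ; apply: leq_trans (leq_card_setU _ _) _.
  by rewrite (mulnDl 2 2); apply: leq_add.
move=> lt; have /subsetPn[z zZ zB] : ~~ (Z \subset B1 :|: B2).
  by apply: contraL lt => /subset_leq_card; rewrite leqNgt.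
exists z => //; apply/eqP; rewrite eqEsubset; move: zB.
by rewrite !inE zZ /= negb_or !negbK.
Qed.

(** * Predicting a separating flip *)

Section Prediction.
Variables (G : sgraph) (Q : finType) (D : {set G}) (c' : G -> Q).

(** The entries are the known color, the adjacencies to the outer representatives and the side of
    [D]. None of them involves the unknown flip. *)
Definition palette := (Q * {ffun Q -> bool} * bool)%type.

Definition outer_rep (a : Q) : option G := [pick x | (x \notin D) && (c' x == a)].

Definition adj_rep (x : G) : {ffun Q -> bool} :=
  [ffun a => if outer_rep a is Some y then adj x y else false].

Definition predict_color (x : G) : palette := (c' x, adj_rep x, x \in D).

Variables (c : G -> Q) (F F' : {ffun Q * Q -> bool}) (z : G) (W : {set G}).
Let H := cflip c F.
Let H' := cflip c' F'.
Hypothesis compH : comp H z = D.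
Hypothesis compH' : comp H' z = D.
Hypothesis zW : {in W, forall w, ~~ connect H z w}.
Hypothesis sepW : {in W &, forall u v, u != v -> ~~ connect H u v}.
Hypothesis colW : {in W, forall w, c @: comp H w = c @: comp H z}.
Hypothesis bigW : #|Q|.+1 < #|W|.

Lemma outer_repP x : x \notin D ->
  exists y, [/\ outer_rep (c' x) = Some y, y \notin D & c' y = c' x].
Proof.
rewrite /outer_rep => xD; case: pickP => [y /andP[yD /eqP]|/(_ x)].
  by exists y.
by rewrite xD eqxx.
Qed.

Let good := [set w in W | [forall a, if outer_rep a is Some y
                                     then ~~ connect H w y else true]].

(** A representative lies in the component of at most one vertex of [W], so at most [#|Q|] vertices
    of [W] fail to be good. *)
Let many_good : 1 < #|good|.
Proof.
set B := W :\: good.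
have: #|B| <= #|Q|.
  pose f w := odflt (c' w) [pick a | if outer_rep a is Some y
                                     then connect H w y else false].
  have fP w : w \in B -> if outer_rep (f w) is Some y
                         then connect H w y else false.
    rewrite !inE => /andP[+ wW]; rewrite wW /= negb_forall => /existsP[a Ha].
    rewrite /f; case: pickP => [b //|/(_ a)] /=.
    by case: (outer_rep a) Ha => [y|//]; rewrite negbK => ->.
  rewrite -(@card_in_imset _ _ f B); first exact: max_card.
  move=> w w' wB w'B eqf; apply/eqP; apply: contraT => nww'.
  have := fP _ wB; have := fP _ w'B; rewrite eqf.
  case: (outer_rep _) => [y|//] w'y wy.
  have wW : w \in W by move: wB; rewrite inE => /andP[].
  have w'W : w' \in W by move: w'B; rewrite inE => /andP[].
  have /negP[] := sepW wW w'W nww'; apply: connect_trans wy _.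
  by rewrite connect_cflipC.
move=> leB; rewrite -(ltn_add2r #|Q|) add1n; apply: leq_trans bigW _.
by rewrite -(cardsID good W) leq_add // subset_leq_card // subsetIr.
Qed.

Let goodW w : w \in good -> w \in W. Proof. by rewrite inE => /andP[]. Qed.

Let compD w x : w \in good -> x \in comp H w -> x \notin D.
Proof.
move=> /goodW/zW nzw xw; rewrite -compH; apply: comp_disjoint xw.
by rewrite connect_cflipC.
Qed.

Let adjD x y : x \notin D -> y \in D -> adj x y = symF F' (c' x) (c' y).
Proof. by rewrite -compH' => xD yD; rewrite adj_sym symFC; apply: cflip_comp_far yD xD. Qed.

(* Outside [D] the color [c'] determines the neighborhood in [D], and [D] meets
   all the [c]-colors occurring near a good vertex. *)
Let rowD w x y u : w \in good -> u \in comp H w -> x \notin D -> y \notin D ->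
  c' x = c' y -> symF F (c x) (c u) = symF F (c y) (c u).
Proof.
move=> wg uw xD yD eqc'.
have: c u \in c @: comp H w by apply: imset_f.
rewrite (colW (goodW wg)) => /imsetP[t tz ->].
have tD : t \in D by rewrite -compH.
rewrite ![symF F _ (c t)]symFC -!(cflip_comp_far tz) ?compH //.
by rewrite ![adj t _]adj_sym !adjD // eqc'.
Qed.

(** As [w] is good, the representative [y] lies outside its component, so [F] decides its adjacency
    to [u]; [rowD] transfers the value to [x]. *)
Let adj_repE w x u y : w \in good -> u \in comp H w -> x \notin D ->
  outer_rep (c' x) = Some y -> adj_rep u (c' x) = symF F (c x) (c u).
Proof.
move=> wg uw xD repx; rewrite ffunE repx.
have [y' [repx' yD eqc']] := outer_repP xD.
move: repx'; rewrite repx => -[?]; subst y'.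
have nwy : y \notin comp H w.
  by move: wg; rewrite inE => /andP[_ /forallP/(_ (c' x))]; rewrite repx inE.
by rewrite (cflip_comp_far uw nwy) symFC (rowD wg uw yD xD eqc').
Qed.

(** The edges leaving components of good vertices dictate the flip; [adj_predict] shows that no
    non-adjacent leaving pair repeats their colors. *)
Let seen (a b : palette) := [exists w in good, exists u in comp H w,
  exists v, [&& v \notin comp H w, predict_color u == a, predict_color v == b
              & adj u v]].

Let seenP a b : reflect (exists w u v, [/\ w \in good, u \in comp H w,
   v \notin comp H w & [/\ predict_color u = a, predict_color v = b & adj u v]])
  (seen a b).
Proof.
apply: (iffP idP).
  move=> /existsP[w /andP[wg /existsP[u /andP[uw /existsP[v]]]]].
  by case/and4P=> vw /eqP ? /eqP ? uv; exists w, u, v.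
case=> w [u [v [wg uw vw [eu ev uv]]]]; apply/existsP; exists w; rewrite wg /=.
apply/existsP; exists u; rewrite uw /=; apply/existsP; exists v.
by rewrite vw eu ev !eqxx.
Qed.

Let Fp : {ffun palette * palette -> bool} :=
  [ffun p => seen p.1 p.2 || seen p.2 p.1].

Let symFp a b : symF Fp a b = seen a b || seen b a.
Proof. by rewrite /symF !ffunE /= [seen b a || _]orbC andbb. Qed.

Let adj_predict w u v : w \in good -> u \in comp H w -> v \notin comp H w ->
  adj u v = symF Fp (predict_color u) (predict_color v).
Proof.
move=> wg uw vw; rewrite symFp; apply/idP/orP.
  by move=> uv; left; apply/seenP; exists w, u, v.
have uD := compD wg uw.
case=> /seenP[w2 [u2 [v2 [w2g u2w v2w [eu ev]]]]]; have u2D := compD w2g u2w.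
  case: eu => ec' erep _; case: ev => ec'v _ eD.
  (* Inside [D], [c'] and [F'] decide both adjacencies; outside, [adj_rep] at the color of [v]
     records the value of [F]. *)
  have [vD|vD] := boolP (v \in D).
    by rewrite !adjD ?eD ?ec' ?ec'v.
  have v2D : v2 \notin D by rewrite eD.
  have [y [repv _ _]] := outer_repP vD.
  rewrite (cflip_comp_far uw vw) (cflip_comp_far u2w v2w) symFC [in X in _ -> X]symFC.
  rewrite (rowD w2g u2w v2D vD ec'v).
  rewrite -(adj_repE wg uw vD repv) -(adj_repE w2g u2w vD repv).
  by rewrite erep.
(* In the reversed orientation, [rowD] reduces both adjacencies to the value of [F] between [u] and
   [u2]. *)
case: eu => ec'v _ eD; case: ev => ec'u _ eDu.
have vD : v \notin D by rewrite -eD.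
have v2D : v2 \notin D by rewrite eDu.
rewrite (cflip_comp_far uw vw) (cflip_comp_far u2w v2w).
rewrite symFC (rowD w2g u2w v2D uD ec'u) symFC [in X in _ -> X]symFC.
by rewrite (rowD wg uw u2D vD ec'v).
Qed.

(** The flip deletes every edge leaving the component of a good vertex, so any two good vertices
    will do. The coloring is known in advance; only [Fp] has to be guessed. *)
Lemma predict_separates : exists Fp : {ffun palette * palette -> bool},
  exists w w', [/\ w \in W, w' \in W, w != w'
    & ~~ connect (cflip predict_color Fp) w w'].
Proof.
exists Fp; have [w [w' [wg w'g nww']]] := card_gt1P many_good.
exists w, w'; split; rewrite ?goodW //.
apply/negP=> cww'.
have w'F : w' \notin comp H w by rewrite inE; apply: sepW; rewrite ?goodW.
have [u [v [_ uv uw vw]]] := connect_leave cww' (comp_refl H w) w'F.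
by move: uv; rewrite /cflip (adj_predict wg uw vw) addbb andbF.
Qed.

End Prediction.

(** * Iterated flips *)

Section Decomposition.
Variables (G : sgraph) (C : finType).

Definition flip_code := ({ffun G -> C} * {ffun C * C -> bool})%type.
Implicit Type h : flip_code.

Definition flip_of h : rel G := cflip h.1 h.2.

(* The flip is one of all of [G]: its components are merely cut down to [A]. *)
Fixpoint decomposable t (A : {set G}) : bool :=
  if t is t'.+1 then
    [exists h : flip_code, [forall x in A,
       decomposable t' (A :&: comp (flip_of h) x)]]
  else #|A| <= 1.

Variable a0 : C.

Lemma decomposable_card_le1 t (A : {set G}) : #|A| <= 1 -> decomposable t A.
Proof.
elim: t A => //= t IHt A leA; apply/existsP; exists ([ffun=> a0], [ffun=> false]).
apply/forall_inP=> x _; apply: IHt; apply: leq_trans leA.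
exact: subset_leq_card (subsetIl _ _).
Qed.

Lemma decomposable_addl n t (A : {set G}) : decomposable t A -> decomposable (n + t) A.
Proof.
have step t' (B : {set G}) : decomposable t' B -> decomposable t'.+1 B.
  elim: t' B => [|t' IHt] B decB; first exact: (@decomposable_card_le1 1).
  have /existsP[h /forall_inP hB] := decB.
  by apply/existsP; exists h; apply/forall_inP=> x xB; apply: IHt (hB x xB).
by move=> decA; elim: n => // n; apply: step.
Qed.

(** One round is spent on each flip of [L]: some component of the flip cuts out a piece that is
    still indecomposable with one round less. *)
Lemma connected_under_flips (L : seq flip_code) n t (A : {set G}) :
  size L <= n -> ~~ decomposable (n + t) A ->
  exists2 B : {set G}, B \subset A /\ ~~ decomposable t B
    & {in L, forall h, {in B &, forall x y, connect (flip_of h) x y}}.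
Proof.
elim: L n A => [|h L IHL] n A.
  move=> _ nA; exists A => //; split=> //.
  by apply: contra nA; apply: decomposable_addl.
case: n => // n; rewrite ltnS addSn /= => leLn.
move/existsPn/(_ h); rewrite negb_forall => /existsP[x].
rewrite negb_imply => /andP[xA /(IHL _ _ leLn)[B [BA nB] conn]].
exists B; first by split=> //; apply: subset_trans BA (subsetIl _ _).
move=> h'; rewrite inE => /predU1P[->|h'L]; last exact: conn.
move=> u v /(subsetP BA)/setIP[_]; rewrite inE => xu.
move=> /(subsetP BA)/setIP[_]; rewrite inE; apply: connect_trans.
by rewrite connect_cflipC.
Qed.

End Decomposition.

(** * Vertex sequences that survive all predicted flips *)

Section Strategy.
Variable k : nat.
Let Q := 'I_k.+1.
Let P := palette Q.

Section Graph.
Variable G : sgraph.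

(** The boolean marks [v] and the value at [ord0] stores adjacency to [v]. Palettes serve as colors
    so that these flips have the type of the predicted ones. *)
Definition isolate (v : G) : flip_code G P :=
  ([ffun x => (ord0, [ffun=> adj x v], x == v)],
   [ffun p : P * P => if p.1.2 then p.2.1.2 ord0 else p.2.2 && p.1.1.2 ord0]).

Lemma isolateP v x : connect (flip_of (isolate v)) v x -> x = v.
Proof.
move=> vx; apply/set1P; apply: contraT => xv.
have [a [b [_ ab /set1P eqa bv]]] := connect_leave vx (set11 v) xv.
rewrite inE in bv; move: ab; rewrite {}eqa /flip_of /cflip /symF /isolate
  /= !ffunE /= eqxx (negPf bv) /=.
by rewrite andbb adj_sym addbb andbF.
Qed.

Definition separates (h : flip_code G Q) (Z : {set G}) : bool :=
  [forall u in Z, forall v in Z, (u != v) ==> ~~ connect (flip_of h) u v].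

Lemma separatesP h (Z : {set G}) :
  reflect {in Z &, forall u v, u != v -> ~~ connect (flip_of h) u v}
          (separates h Z).
Proof.
apply: (iffP forall_inP) => [sep u v uZ vZ uv | sep u uZ].
  by have /forall_inP/(_ v vZ)/implyP := sep u uZ; apply.
by apply/forall_inP=> v vZ; apply/implyP; apply: sep.
Qed.

(** Chosen from [Z] alone, hence available before the flip supplied by flip-flatness is known. The
    default is never taken if some flip separates [Z]. *)
Definition separator (Z : {set G}) : flip_code G Q :=
  odflt ([ffun=> ord0], [ffun=> false]) [pick h | separates h Z].

Lemma separatorP h (Z : {set G}) : separates h Z -> separates (separator Z) Z.
Proof. by rewrite /separator; case: pickP => [//|/(_ h)->]. Qed.

Definition predicted_flip (t : {set G} * G * {ffun P * P -> bool}) :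
    flip_code G P :=
  let h := separator t.1.1 in
  ([ffun x => predict_color (comp (flip_of h) t.1.2) h.1 x], t.2).

(** All guesses of the set [Z], the vertex [z] and the relation [Fp] are listed. The isolating flips
    keep vertices of [S] out of later pieces. *)
Definition predictions (S : {set G}) : {set flip_code G P} :=
  isolate @: S :|: predicted_flip @: setX (setX (powerset S) S) setT.

Definition cost (s : nat) := s + 2 ^ s * s * #|{ffun P * P -> bool}|.

Lemma card_predictions (S : {set G}) n : #|S| <= n -> #|predictions S| <= cost n.
Proof.
move=> leSn; apply: leq_trans (leq_card_setU _ _) _.
apply: leq_add; first exact: leq_trans (leq_imset_card _ _) leSn.
apply: leq_trans (leq_imset_card _ _) _.
rewrite !cardsX card_powerset cardsT leq_mul2r; apply/orP; right.
by rewrite leq_mul // leq_pexp2l.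
Qed.

(** All cuts are considered because the place where a flip-flat subset will be divided is not known;
    [past] holds the vertices chosen earlier in the induction. *)
Definition confined (past s : seq G) := forall s1 s2, s = s1 ++ s2 ->
  {in predictions [set x in past ++ s1], forall h,
   {in s2 &, forall x y, connect (flip_of h) x y}}.

End Graph.

(** Pick [v] in [A], shrink [A] by [connected_under_flips] to a piece connected under all flips
    predicted from [past] and [v], and continue there. The rounds in [cost j.+1] pay for the
    shrinking. *)
Lemma confined_seq n j : exists T, forall (G : sgraph) (past : seq G) (A : {set G}),
  size past = j -> ~~ decomposable P T A ->
  {in predictions [set x in past], forall h,
     {in A &, forall x y, connect (flip_of h) x y}} ->
  exists s, [/\ size s = n, uniq s, {subset s <= A} & confined past s].
Proof.
pose a0 : P := (ord0, [ffun=> false], false).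
elim: n j => [|n IHn] j.
  exists 0 => G past A _ _ connA; exists [::]; split=> // -[|//] [|//] _ h _ x y.
  by rewrite in_nil.
have [T stepT] := IHn j.+1; exists (cost j.+1 + T) => G past A sz_past nA connA.
have [v vA] : exists v, v \in A.
  apply/set0Pn; apply: contraNneq nA => ->.
  by apply: decomposable_card_le1 => //; rewrite cards0.
pose past' := rcons past v; pose L := enum (predictions [set x in past']).
have szL : size L <= cost j.+1.
  rewrite -cardE; apply: card_predictions; rewrite cardsE.
  by apply: leq_trans (card_size _) _; rewrite size_rcons sz_past.
have [B [BA nB] connB] := connected_under_flips a0 szL nA.
have connB' : {in predictions [set x in past'], forall h,
     {in B &, forall x y, connect (flip_of h) x y}}.
  by move=> h hL; apply: connB; rewrite mem_enum.
(* A piece containing [v] and connected under [isolate v] would be a singleton, hence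
   decomposable. *)
have vB : v \notin B.
  apply: contra nB => vB; apply: decomposable_card_le1 => //.
  rewrite -(cards1 v); apply: subset_leq_card; apply/subsetP=> x xB.
  apply/set1P; apply: isolateP; apply: connB' => //.
  by rewrite inE imset_f // inE mem_rcons mem_head.
have sz' : size past' = j.+1 by rewrite size_rcons sz_past.
have [s [szs us sB conf]] := stepT G past' B sz' nB connB'.
exists (v :: s); split=> /=.
- by rewrite szs.
- by rewrite us andbT; apply: contra vB; apply: sB.
- by move=> x /predU1P[->//|/sB/(subsetP BA)].
(* A cut before [v] is covered by the hypothesis on [A], a later one by induction. *)
move=> [|v1 s1] s2 /=.
  rewrite cats0 => {s2}<- h hp x y xs ys; apply: connA => //.
    by case/predU1P: xs => [->//|/sB/(subsetP BA)].
  by case/predU1P: ys => [->//|/sB/(subsetP BA)].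
by case=> <- eqs; rewrite -cat_rcons; apply: conf.
Qed.

End Strategy.

(** * From flip-flatness to bounded decompositions *)

Lemma kflip_flip_code (k : nat) (G : sgraph) (H : rel G) :
  is_kflip k H -> exists h : flip_code G 'I_k.+1, H =2 flip_of h.
Proof.
case=> K [F [partK leKk _ symF_F defH]].
(* A color is the position of a block in [enum K]; the successor keeps the color type inhabited. *)
pose c (x : G) : 'I_k.+1 := inord (index (pblock K x) (enum K)).
pose cls (i : 'I_k.+1) := nth set0 (enum K) i.
have cK x : cls (c x) = pblock K x.
  have xK : pblock K x \in enum K.
    by rewrite mem_enum pblock_mem // (cover_partition partK).
  rewrite /cls inordK ?nth_index // ltnS ltnW //.
  by apply: leq_trans leKk; rewrite cardE index_mem.
exists ([ffun x => c x], [ffun p => (cls p.1, cls p.2) \in F]) => u v.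
by rewrite defH /flip_adj /flip_of /cflip /symF !ffunE /= !cK symF_F andbb.
Qed.

(** Turns a cut of a selected subsequence into a cut of the whole sequence, to which [confined]
    applies. *)
Lemma filter_eq_cat (T : eqType) (a : pred T) (s t1 t2 : seq T) :
  filter a s = t1 ++ t2 ->
  exists s1 s2, [/\ s = s1 ++ s2, {subset t1 <= s1} & {subset t2 <= s2}].
Proof.
elim: s t1 => [|x s IHs] t1 /=.
  by case: t1 => //; case: t2 => // _; exists [::], [::].
case: ifP => [_|_ /IHs[s1 [s2 [-> sub1 sub2]]]]; last first.
  by exists (x :: s1), s2; split=> // y /sub1; rewrite inE orbC => ->.
case: t1 => [|y t1] /=.
  move=> <-; exists [::], (x :: s); split=> // z; rewrite !inE mem_filter.
  by case: eqP => //= _ /andP[].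
case=> <- /IHs[s1 [s2 [-> sub1 sub2]]]; exists (x :: s1), s2; split=> // z.
by rewrite !inE; case: eqP => //= _; apply: sub1.
Qed.

Lemma flip_flat_decomposable (C : graph_class) : distance_oo_flip_flat C ->
  exists k T, forall G, C G -> decomposable (palette 'I_k.+1) T [set: G].
Proof.
case=> N [k flat]; pose Q := 'I_k.+1.
pose p := (4 * #|{: Q * Q * Q * Q}|).+1.
(* The factor [#|{set Q}|] pays for equalizing the color sets of the components. Then [p] vertices
   form [Z], enough for [exists_common_comp], and more than [k.+2] remain for
   [predict_separates]. *)
pose m := ((p + k.+2) * #|{set Q}|).+1.
have [T stepT] := confined_seq k (N m) 0.
exists k, T => G CG; apply: contraT => ndec.
have [|s [szs us _ conf]] := stepT G [::] [set: G] erefl ndec.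
  move=> h; rewrite inE => /orP[] /imsetP[x + _]; rewrite !inE //.
  by rewrite !andbF.
have [|Ws [H [/subsetP WsW leWs flipH sepH]]] := flat m G [set x in s] CG.
  by rewrite cardsE (card_uniqP us) szs.
have [h eqH] := kflip_flip_code flipH.
have {eqH}sep : {in Ws &, forall u v, u != v -> ~~ connect (flip_of h) u v}.
  by move=> u v uW vW uv; rewrite -(eq_connect eqH) sepH.
have [t] := pigeonhole (fun w => h.1 @: comp (flip_of h) w) leWs.
set W1 := [set x in Ws | _] => leW1.
pose sW := filter (mem W1) s.
have szW : size sW = #|W1|.
  rewrite -(card_uniqP (filter_uniq (mem W1) us)); apply: eq_card => x.
  rewrite mem_filter inE /=; apply: andb_idr => xW1; move: (xW1); rewrite inE.
  by case/andP=> /WsW; rewrite inE.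
have W1E x : x \in sW -> x \in Ws /\ h.1 @: comp (flip_of h) x = t.
  by rewrite mem_filter /= inE => /andP[/andP[-> /eqP->]].
have [s1 [s2 [eqs sub1 sub2]]] := filter_eq_cat (esym (cat_take_drop p sW)).
have usW : uniq (take p sW ++ drop p sW) by rewrite cat_take_drop filter_uniq.
move: usW; rewrite cat_uniq => /and3P[ut /hasPn disj ud].
pose Z := [set x in take p sW]; pose W2 := [set x in drop p sW].
have cardZ : #|Z| = p.
  rewrite cardsE (card_uniqP ut) size_takel // szW ltnW //.
  by apply: leq_trans leW1; rewrite ltnS leq_addr.
have ltW2 : #|Q|.+1 < #|W2|.
  by rewrite cardsE (card_uniqP ud) size_drop szW card_ord ltn_subRL.
have ZsW z : z \in Z -> z \in sW by rewrite inE => /mem_take.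
have W2sW w : w \in W2 -> w \in sW by rewrite inE => /mem_drop.
have sepZ : {in Z &, forall u v, u != v -> ~~ connect (flip_of h) u v}.
  move=> u v /ZsW/W1E[uW _] /ZsW/W1E[vW _]; exact: sep.
set h' := separator k Z.
have sepZ' : {in Z &, forall u v, u != v -> ~~ connect (flip_of h') u v}.
  by apply/separatesP; apply: (@separatorP _ _ h); apply/separatesP.
(* The flips [h] and [h'] may differ, but both separate [Z]. *)
have [|z zZ eqD] := exists_common_comp sepZ sepZ'; first by rewrite cardZ.
have [||| |Fp [w [w' [wW w'W _]]]] :=
  @predict_separates G Q (comp (flip_of h') z) h'.1 h.1 h.2 h'.2 z W2 eqD erefl.
- move=> w wW; apply: sep.
  + by have [] := W1E z (ZsW _ zZ).
  + by have [] := W1E w (W2sW _ wW).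
  apply: contraTneq wW => <-; rewrite inE; apply/negP=> /disj /negP[].
  by move: zZ; rewrite inE.
- move=> u v /W2sW/W1E[uW _] /W2sW/W1E[vW _]; exact: sep.
- move=> w /W2sW/W1E[_ ->]; by have [_ ->] := W1E z (ZsW _ zZ).
- exact: ltW2.
(* As [Z] lies before the cut, this flip was predicted there, so confinement connects [w] and [w'],
   which lie after the cut. *)
case/negP; have mem : predicted_flip (Z, z, Fp) \in predictions k [set x in s1].
  rewrite inE; apply/orP; right; apply: imset_f; rewrite !inE /= andbT.
  apply/andP; split; last by apply: sub1; move: zZ; rewrite inE.
  by apply/subsetP=> x; rewrite !inE; apply: sub1.
have ws2 : w \in s2 by apply: sub2; move: wW; rewrite inE.
have w's2 : w' \in s2 by apply: sub2; move: w'W; rewrite inE.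
have <- : connect (flip_of (predicted_flip (Z, z, Fp))) w w' =
          connect (cflip (predict_color (comp (flip_of h') z) h'.1) Fp) w w'.
  by apply: eq_connect => u v; rewrite /flip_of /cflip /= !ffunE.
exact: (conf s1 s2 eqs _ mem w w' ws2 w's2).
Qed.

(** * Distances in trees *)

Section Distance.
Variable T : sgraph.

Lemma dist_le (x : T) p : path (@adj T) x p -> dist x (last x p) <= size p.
Proof.
move=> xp; rewrite /dist; set P := (fun n : nat => _).
have [lt|ge] := ltnP (size p) #|T|; last first.
  by apply: leq_trans (find_size _ _) _; rewrite size_iota.
rewrite leqNgt; apply/negP=> /(before_find 0); rewrite nth_iota // add0n.
by move/existsP; apply; exists (in_tuple p); rewrite /= xp eqxx.
Qed.

Lemma dist_walk (x y : T) : connect (@adj T) x y ->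
  exists p, [/\ path (@adj T) x p, last x p = y & size p = dist x y].
Proof.
case/connectP=> p0 /shortenP[p xp up _] ->{y p0}.
rewrite /dist; set P := (fun n : nat => _).
have hasP : has P (iota 0 #|T|).
  apply/hasP; exists (size p).
    rewrite mem_iota add0n /=; move/card_uniqP: up => /= <-; exact: max_card.
  by apply/existsP; exists (in_tuple p); rewrite /= xp eqxx.
have := nth_find 0 hasP; rewrite nth_iota; last by rewrite -[X in _ < X](size_iota 0) -has_find.
rewrite add0n => /existsP[q /andP[xq /eqP lq]].
by exists q; rewrite lq size_tuple.
Qed.

Lemma dist_sym (x y : T) : connect (@adj T) x y -> dist x y = dist y x.
Proof.
have half u v : connect (@adj T) u v -> dist v u <= dist u v.
  case/dist_walk=> p [up lp <-].
  have := @dist_le v (rev (belast u p)); rewrite size_rev size_belast.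
  rewrite -lp rev_path (eq_path (e' := @adj T)) => [/(_ up)|a b]; last exact: adj_sym.
  by case: p {up lp} => //= a p; rewrite rev_cons last_rcons.
move=> xy; apply/eqP; rewrite eqn_leq !half //.
by rewrite (sym_connect_sym (@adj_sym T)).
Qed.

Lemma dist_eq0 (x y : T) : connect (@adj T) x y -> (dist x y == 0) = (x == y).
Proof.
move=> xy; apply/eqP/eqP => [d0|<-].
  by have [[|a p] [_ lp sz]] := dist_walk xy; rewrite d0 in sz.
by apply/eqP; rewrite -leqn0; apply: (@dist_le x [::]).
Qed.

Lemma dist_triangle (x y z : T) :
  connect (@adj T) x y -> connect (@adj T) y z ->
  dist x z <= dist x y + dist y z.
Proof.
move=> /dist_walk[p [xp lp <-]] /dist_walk[q [yq lq <-]].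
by rewrite -size_cat -lq -lp -last_cat dist_le // cat_path xp lp.
Qed.

Definition avoid (x : T) : rel T := fun u v => [&& adj u v, u != x & v != x].

Lemma avoid_path (x u : T) p :
  path (@adj T) u p -> x \notin u :: p -> connect (avoid x) u (last u p).
Proof.
move=> up xp; apply/connectP; exists p => //.
elim: p u up xp => //= v p IHp u /andP[uv vp].
rewrite in_cons negb_or => /andP[xu xvp]; rewrite IHp // andbT /avoid uv eq_sym xu.
by move: xvp; rewrite in_cons negb_or eq_sym => /andP[].
Qed.

Lemma avoidC (x : T) : connect_sym (avoid x).
Proof.
by apply: sym_connect_sym => u v; rewrite /avoid adj_sym; do 2!case: (_ != x).
Qed.

Lemma avoid_self (x u : T) : connect (avoid x) x u -> x = u.
Proof. by case/connectP=> -[|v p] //=; rewrite /avoid eqxx andbF. Qed.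

Hypothesis conn : connected T.

(** A shortest walk from [u] to [v] must visit [x], where it splits into two walks. *)
Lemma dist_separated (x u v : T) :
  ~~ connect (avoid x) u v -> dist u v = dist u x + dist x v.
Proof.
move=> nuv; apply/eqP; rewrite eqn_leq dist_triangle //=.
have [p [up lp <-]] := dist_walk (conn u v).
have: x \in u :: p by apply: contraR nuv => xp; rewrite -lp avoid_path.
move=> xp; case/splitPl: xp up lp => p1 p2 lp1; rewrite cat_path lp1 last_cat lp1.
by case/andP=> up1 xp2 <-; rewrite size_cat leq_add // -?lp1 ?dist_le ?lp1.
Qed.

Hypothesis acycl : acyclic T.

(** A simple path from [a] to [b] avoiding [x] would close up through [x] to a cycle of size at
    least 3. *)
Lemma acyclic_separated (x a b : T) :
  adj x a -> adj x b -> a != b -> ~~ connect (avoid x) a b.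
Proof.
move=> xa xb nab; apply/negP=> /connectP[p0 /shortenP[p ap up _] lb].
have ap' : path (@adj T) a p by apply: sub_path ap => u v /andP[].
have xap : x \notin a :: p.
  have nxa : x != a by apply: contraTneq xa => ->; rewrite adj_irrefl.
  rewrite in_cons negb_or nxa /=; elim: p a ap {up lb ap' xa nab nxa} => //= v p IHp a.
  by case/andP=> /and3P[_ _ nvx] /IHp xp; rewrite in_cons negb_or eq_sym nvx.
have := acycl (p := x :: a :: p); rewrite /ucycle /cycle rcons_path /= xa ap' -lb.
rewrite adj_sym xb xap; move: up => /= -> /(_ isT).
by case: (p) lb nab => [/= ->|//]; rewrite eqxx.
Qed.

(** The next-to-last vertex separates [r] from the last one, so the distances add up along the
    path. *)
Lemma uniq_path_dist (r : T) p :
  path (@adj T) r p -> uniq (r :: p) -> dist r (last r p) = size p.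
Proof.
elim/last_ind: p => [|q b IHq]; first by move=> _ _; apply/eqP; rewrite dist_eq0.
rewrite rcons_path last_rcons size_rcons -rcons_cons rcons_uniq.
case/andP=> rq; set x := last r q => xb /andP[brq urq].
have nxb : x != b by apply: contraNneq brq => <-; apply: mem_last.
have sep : ~~ connect (avoid x) r b.
  case/lastP: q @x {IHq} rq xb nxb brq urq => [|q x'] x rq xb nxb brq urq.
    by apply: contra nxb => /avoid_self ->.
  move: @x xb nxb; rewrite last_rcons => x xb nxb.
  move: rq urq brq; rewrite rcons_path -rcons_cons rcons_uniq => /andP[rq ax] /andP[xq _].
  rewrite mem_rcons in_cons negb_or => /andP[_ bq].
  apply: contraL (avoid_path rq xq) => rb; rewrite avoidC; apply/negP=> ar.
  have /negP[] : ~~ connect (avoid x) (last r q) b.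
    apply: acyclic_separated; rewrite // 1?adj_sym //.
    by apply: contraNneq bq => <-; apply: mem_last.
  exact: connect_trans ar rb.
rewrite (dist_separated sep) IHq // -addn1; congr (_ + _); apply/eqP.
rewrite eqn_leq (@dist_le x [:: b]) /= ?xb // lt0n dist_eq0 ?nxb //.
Qed.

Lemma tree_path (r x : T) :
  exists p, [/\ path (@adj T) r p, uniq (r :: p) & last r p = x].
Proof.
by have /connectP[p0 /shortenP[p rp up _] ->] := conn r x; exists p.
Qed.

End Distance.

(** * From tree-models to flips *)

Lemma coloring_kflip (G : sgraph) (C : finType) (c : G -> C) (r : rel C) :
  symmetric r ->
  is_kflip #|C| (fun u v : G => (u != v) && (adj u v (+) r (c u) (c v))).
Proof.
move=> sym_r; pose K := preim_partition c [set: G].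
have pblockE x y : (y \in pblock K x) = (c x == c y).
  by rewrite pblock_equivalence_partition ?inE //; split=> // /eqP->.
have partK : partition K [set: G] by apply: preim_partitionP.
have inK x : pblock K x \in K by rewrite pblock_mem // (cover_partition partK).
pose F := [set AB in setX K K |
  [exists x in AB.1, exists y in AB.2, r (c x) (c y)]].
exists K, F; split=> //.
- have: K \subset (fun a => [set y | c y == a]) @: [set: C].
    apply/subsetP=> B BK; have [x xB] : exists x, x \in B.
      apply/set0Pn; apply: contraTneq BK => ->.
      by have /and3P[] := partK.
    have -> : B = [set y | c y == c x].
      rewrite -(def_pblock (partition_trivIset partK) BK xB).
      by apply/setP=> y; rewrite pblockE inE eq_sym.
    exact: imset_f.
  move/subset_leq_card/leq_trans; apply.
  by apply: leq_trans (leq_imset_card _ _) _; rewrite cardsT.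
- by apply/subsetP=> AB; rewrite inE => /andP[].
- have half A B : (A, B) \in F -> (B, A) \in F.
    rewrite !inE /= => /andP[/andP[-> ->] /=].
    case/existsP=> x /andP[xA /existsP[y /andP[yB rxy]]].
    apply/existsP; exists y; rewrite yB; apply/existsP; exists x.
    by rewrite xA sym_r.
  by move=> A B; apply/idP/idP; apply: half.
move=> u v; rewrite /flip_adj; congr (_ && (_ (+) _)).
rewrite !inE /= !inK /=; apply/idP/existsP.
  move=> ruv; exists u; rewrite pblockE eqxx; apply/existsP; exists v.
  by rewrite pblockE eqxx.
case=> x; rewrite pblockE => /andP[/eqP-> /existsP[y]].
by rewrite pblockE => /andP[/eqP->].
Qed.

Fixpoint branching_bound (m d : nat) : nat :=
  if d is d'.+1 then (m * branching_bound m d').+1 else 1.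

(** Either [m] different first entries occur and [q] is empty, or one first entry is shared by so
    many sequences that induction applies to their tails. The successor in the bound allows for one
    empty sequence. *)
Lemma common_branching (I T : finType) (m d : nat) (P : I -> seq T) (W : {set I}) :
  {in W &, injective P} -> {in W, forall w, size (P w) <= d} ->
  branching_bound m d < #|W| ->
  exists (q : seq T) (W' : {set I}) (y : I -> T),
    [/\ W' \subset W, m <= #|W'|, {in W' &, injective y}
      & {in W', forall w, exists p, P w = q ++ y w :: p}].
Proof.
elim: d P W => [|d IHd] P W injP szP /=.
  move=> /card_gt1P[u [v [uW vW]]]; case/eqP; apply: injP => //.
  by move: (szP u uW) (szP v vW); rewrite !leqn0 => /nilP-> /nilP->.
set b := branching_bound m d; set W1 := [set w in W | P w != [::]] => ltW.
have ltW1 : m * b < #|W1|.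
  rewrite -ltnS; apply: leq_trans ltW _.
  have: #|[set w in W | P w == [::]]| <= 1.
    rewrite leqNgt; apply/negP=> /card_gt1P[u [v []]].
    rewrite !inE => /andP[uW /eqP Pu] /andP[vW /eqP Pv]; case/eqP.
    by apply: injP => //; rewrite Pv.
  move=> le1; rewrite -(cardsID [set w | P w == [::]] W) -add1n.
  apply: leq_add.
    by apply: leq_trans le1; apply: eq_leq; apply: eq_card => w; rewrite !inE.
  by apply: eq_leq; apply: eq_card => w; rewrite !inE andbC.
have W1W : W1 \subset W by apply/subsetP=> w; rewrite inE => /andP[].
have [w0 w0W1] : exists w, w \in W1 by apply/card_gt0P; apply: leq_ltn_trans ltW1.
have t0 : T by move: w0W1; rewrite inE; case: (P w0) => [|//]; rewrite andbF.
pose y w := head t0 (P w).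
have Py w : w \in W1 -> P w = y w :: behead (P w).
  by rewrite inE /y; case: (P w) => [|t s]; rewrite ?andbF.
have [leY|ltY] := leqP m #|y @: W1|.
  have [g gP] : exists g : T -> I, forall t, t \in y @: W1 -> g t \in W1 /\ y (g t) = t.
    apply: (@fin_all_exists _ (fun=> I)
      (fun t w => t \in y @: W1 -> w \in W1 /\ y w = t)) => t.
    have [/imsetP[w wW ->]|] := boolP (t \in y @: W1).
      by exists w.
    by exists w0.
  exists [::], (g @: (y @: W1)), y.
  have inj_y : {in g @: (y @: W1) &, injective y}.
    move=> _ _ /imsetP[t tY ->] /imsetP[t' t'Y ->].
    by have [[_ ->] [_ ->]] := (gP t tY, gP t' t'Y) => ->.
  have sub : g @: (y @: W1) \subset W1.
    by apply/subsetP=> _ /imsetP[t tY ->]; have [] := gP t tY.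
  split=> //; first exact: subset_trans sub W1W.
    rewrite card_in_imset // => t t' tY t'Y eqg.
    by have [[_ <-] [_ <-]] := (gP t tY, gP t' t'Y); rewrite eqg.
  by move=> w wg; exists (behead (P w)); rewrite -Py // (subsetP sub).
have ltb : b * #|y @: W1| < #|W1|.
  by apply: leq_ltn_trans ltW1; rewrite mulnC leq_mul2r ltnW ?orbT.
have [t] := pigeonhole_imset ltb.
set W2 := [set w in W1 | _] => ltW2.
have W2P w : w \in W2 -> [/\ w \in W1, w \in W & P w = t :: behead (P w)].
  by rewrite inE => /andP[wW1 /eqP <-]; rewrite (subsetP W1W) // -Py.
have [|| q [W' [y' [sub leW' injy' Pq]]]] := IHd (behead \o P) W2 _ _ ltW2.
- move=> u v /W2P[_ uW Pu] /W2P[_ vW Pv] /= eqb; apply: injP => //.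
  by rewrite Pu Pv eqb.
- by move=> w /W2P[_ /szP + Pw]; rewrite Pw /=.
exists (t :: q), W', y'; split=> //.
  by apply: subset_trans sub _; apply/subsetP=> w /W2P[].
move=> w wW'; have [p Pp] := Pq w wW'; exists p.
by have [_ _ ->] := W2P _ (subsetP sub _ wW'); rewrite [behead _]Pp.
Qed.

Section TreeModelFlip.
Variables (m d : nat) (G : sgraph) (M : tree_model m d G).
Let T := tm_tree M.
Let r := tm_root M.
Let leaf_of := @tm_leaf _ _ _ M.
Let conn : connected T := (tm_treeP M).1.
Let acycl : acyclic T := (tm_treeP M).2.

(** A root path not ending in a leaf extends to a child of its end, and root paths to leaves have
    length [d]. *)
Lemma tree_model_path_size p :
  path (@adj T) r p -> uniq (r :: p) -> size p <= d.
Proof.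
move: {2}(#|T| - size p) (leqnn (#|T| - size p)) => n.
elim: n p => [|n IHn] p len rp up.
  have: size (r :: p) <= #|T| by move/card_uniqP: (up) => <-; apply: max_card.
  by rewrite /= ltnNge -subn_eq0 -leqn0 len.
have [lf|] := boolP (leaf r (last r p)); first by rewrite (tm_depth rp up lf).
rewrite negb_forall => /existsP[z]; rewrite negbK => /andP[lz /eqP dz].
have rz : path (@adj T) r (rcons p z) by rewrite rcons_path rp.
have uz : uniq (r :: rcons p z).
  rewrite -rcons_cons rcons_uniq up andbT; apply/negP=> zp.
  have := uniq_path_dist conn acycl rp up.
  move: dz; case/splitPl: zp rp => p1 p2 lp1; rewrite cat_path => /andP[rp1 _].
  move=> dz /eqP; rewrite -(eqn_add2l 1) !add1n -dz -lp1 => /eqP dp1.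
  by have := dist_le rp1; rewrite dp1 size_cat ltnNge leq_addr.
have := IHn _ _ rz uz; rewrite size_rcons subnS => /(_ _)/ltnW; apply.
by rewrite -subn1 leq_subLR add1n.
Qed.

Lemma tree_model_dist (x y : T) : dist x y <= 2 * d.
Proof.
have half z : dist r z <= d.
  have [p [rp up <-]] := tree_path conn r z.
  by rewrite (uniq_path_dist conn acycl rp up) tree_model_path_size.
apply: leq_trans (dist_triangle (conn x r) (conn r y)) _.
by rewrite mul2n -addnn leq_add // dist_sym.
Qed.

Lemma tree_model_flip n (W : {set G}) : branching_bound n d < #|W| ->
  exists (Ws : {set G}) (H : rel G),
    [/\ Ws \subset W, n <= #|Ws|, is_kflip #|{: 'I_m * 'I_(2 * d).+1}| H
      & {in Ws &, forall u v, u != v -> ~~ connect H u v}].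
Proof.
have [P PP] : exists P : G -> seq T, forall w,
    [/\ path (@adj T) r (P w), uniq (r :: P w) & last r (P w) = leaf_of w].
  apply: (@fin_all_exists _ (fun=> seq T) (fun w p =>
    [/\ path (@adj T) r p, uniq (r :: p) & last r p = leaf_of w])) => w.
  exact: tree_path.
move=> ltW; have [||q [Ws [y [sub leWs injy Pq]]]] :=
  @common_branching _ _ n d P W _ _ ltW.
- move=> u v _ _ eqP; suff: leaf_of u = leaf_of v by apply: tm_leaf_inj.
  by have [[_ _ <-] [_ _ <-]] := (PP u, PP v); rewrite eqP.
- by move=> w _; have [rp up _] := PP w; apply: tree_model_path_size.
(* The node at which the root paths to [Ws] branch. *)
pose x := last r q.
pose color u : 'I_m * 'I_(2 * d).+1 :=
  (tm_color M u, inord (dist (leaf_of u) x)).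
(* Between components of [T - x] the tree distance is the sum of the distances to [x], so there
   [sig] reproduces adjacency. *)
pose sig (a b : 'I_m * 'I_(2 * d).+1) := tm_sig M (a.1, b.1, a.2 + b.2).
have sym_sig : symmetric sig by move=> a b; rewrite /sig tm_sig_sym addnC.
exists Ws, (fun u v => (u != v) && (adj u v (+) sig (color u) (color v))).
split=> //; first exact: coloring_kflip.
have branch w : w \in Ws -> adj x (y w) /\ connect (avoid x) (y w) (leaf_of w).
  move=> wWs; have [p Pw] := Pq w wWs; have [+ + <-] := PP w.
  rewrite Pw cat_path last_cat -cat_cons cat_uniq /=.
  case/andP=> _ /andP[xy yp] /andP[_ /andP[/norP[+ /hasPn disj] _]].
  rewrite -/x in xy *; split=> //; apply: avoid_path => //.
  rewrite in_cons negb_or; apply/andP; split.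
    by apply: contraTneq xy => <-; rewrite adj_irrefl.
  by apply/negP=> /disj/negP[]; apply: mem_last.
have step u v : (u != v) && (adj u v (+) sig (color u) (color v)) ->
    connect (avoid x) (leaf_of u) (leaf_of v).
  case/andP=> nuv; apply: contraLR => /(dist_separated conn) duv.
  rewrite (tm_adjP M nuv) /sig /color /= !inordK ?ltnS ?tree_model_dist //.
  by rewrite -/(leaf_of u) -/(leaf_of v) duv (dist_sym (conn x _)) addbb.
move=> u v uW vW nuv; apply/negP=> /connectP[p up lv].
have: connect (avoid x) (leaf_of u) (leaf_of v).
  rewrite lv; elim: p u up {uW nuv lv} => //= a p IHp u /andP[/step ua /IHp].
  exact: connect_trans.
have [xyu yu] := branch u uW; have [xyv yv] := branch v vW.
move=> uv; have /negP[] : ~~ connect (avoid x) (y u) (y v).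
  by apply: acyclic_separated => //; apply: contra nuv => /eqP/(injy _ _ uW vW)->.
by apply: connect_trans (connect_trans yu uv) _; rewrite avoidC.
Qed.

End TreeModelFlip.

Lemma shrubdepth_flip_flat (C : graph_class) :
  bounded_shrubdepth C -> distance_oo_flip_flat C.
Proof.
case=> m [d model]; exists (fun n => (branching_bound n d).+1).
exists #|{: 'I_m * 'I_(2 * d).+1}| => n G W CG leW.
by have [M] := model G CG; apply: tree_model_flip M _ _ leW.
Qed.

(** * Trees from nested partitions *)

Section LayeredTree.
Variables (G : sgraph) (d : nat) (part : nat -> G -> {set G}).
Hypothesis part0 : forall u, part 0 u = [set: G].
Hypothesis part_refl : forall i u, u \in part i u.
Hypothesis part_eq : forall i u v, v \in part i u -> part i v = part i u.
Hypothesis partS : forall i u, part i.+1 u \subset part i u.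
Hypothesis part_d : forall u, part d u = [set u].

Let part_mono i j u : i <= j -> part j u \subset part i u.
Proof.
by move/subnK <-; elim: (j - i) => // n; apply: subset_trans (partS _ _).
Qed.

(** The level is stored because one set may be a block at several levels. *)
Definition layer_node :=
  {x : 'I_d.+1 * {set G} | [exists u, x.2 == part x.1 u]}.

Let lev (x : layer_node) : nat := (val x).1.
Let blk (x : layer_node) : {set G} := (val x).2.

Let block_proof (i : 'I_d.+1) u :
  [exists v, (i, part i u).2 == part (i, part i u).1 v].
Proof. by apply/existsP; exists u. Qed.

Definition block_node (i : nat) (u : G) : layer_node :=
  exist _ (inord i, part (inord i) u) (block_proof (inord i) u).

Let lev_le x : lev x <= d. Proof. by rewrite -ltnS ltn_ord. Qed.

Let lev_block i u : i <= d -> lev (block_node i u) = i.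
Proof. by move=> leid; rewrite /lev /= inordK. Qed.

Let blk_block i u : i <= d -> blk (block_node i u) = part i u.
Proof. by move=> leid; rewrite /blk /= inordK. Qed.

Let node_eq x y : lev x = lev y -> blk x = blk y -> x = y.
Proof.
move=> eql eqb; apply/val_inj/eqP.
by rewrite [val x]surjective_pairing [val y]surjective_pairing xpair_eqE -val_eqE;
  apply/andP; split; apply/eqP.
Qed.

Let blkE x u : u \in blk x -> blk x = part (lev x) u.
Proof.
rewrite /blk /lev; case: x => [[i B] /= /existsP[v /= /eqP ->]].
by move/part_eq.
Qed.

Let blk_ex x : exists u, u \in blk x.
Proof.
by rewrite /blk; case: x => [[i B] /= /existsP[v /= /eqP->]]; exists v.
Qed.

Let node_block x u : u \in blk x -> x = block_node (lev x) u.
Proof.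
by move=> ux; apply: node_eq; rewrite ?lev_block ?blk_block // (blkE ux).
Qed.

Definition layer_parent (x y : layer_node) : bool :=
  (lev y == (lev x).+1) && (blk y \subset blk x).

Definition layer_adj (x y : layer_node) : bool :=
  layer_parent x y || layer_parent y x.

Fact layer_adj_sym : symmetric layer_adj.
Proof. by move=> x y; rewrite /layer_adj orbC. Qed.

Fact layer_adj_irrefl : irreflexive layer_adj.
Proof. by move=> x; rewrite /layer_adj /layer_parent orbb eqn_leq ltnn andbF. Qed.

Let u0 : G. Proof. by have /card_gt0P/sigW[u _] := vertex_gt0 G; exact: u. Qed.

Let root : layer_node := block_node 0 u0.

Fact layer_gt0 : 0 < #|{: layer_node}|.
Proof. by apply/card_gt0P; exists root. Qed.

Definition layer_tree : sgraph := SGraph layer_adj_sym layer_adj_irrefl layer_gt0.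

Let T := layer_tree.

Let lev_root : lev root = 0. Proof. exact: lev_block. Qed.

Let rootE u : root = block_node 0 u.
Proof. by apply: node_eq; rewrite ?lev_block ?blk_block // !part0. Qed.

Let block_step i u : i < d -> @adj T (block_node i u) (block_node i.+1 u).
Proof.
move=> lt; rewrite /= /layer_adj /layer_parent !lev_block ?(ltnW lt) // eqxx /=.
by rewrite !blk_block ?(ltnW lt) // partS.
Qed.

Let parent_unique (x y z : T) : layer_parent x z -> layer_parent y z -> x = y.
Proof.
case/andP=> /eqP lx /subsetP sx /andP[/eqP ly /subsetP sy].
have eql : lev x = lev y by move: ly; rewrite lx => -[].
have [u uz] := blk_ex z; apply: node_eq => //.
by rewrite (blkE (sx u uz)) (blkE (sy u uz)) eql.
Qed.

Let adj_lev (x y : T) : adj x y -> lev x = (lev y).+1 \/ lev y = (lev x).+1.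
Proof. by rewrite /= /layer_adj /layer_parent => /orP[] /andP[/eqP]; [right|left]. Qed.

Let block_dist i j u : i + j <= d ->
  exists p, [/\ path (@adj T) (block_node i u) p,
                last (block_node i u) p = block_node (i + j) u & size p = j].
Proof.
elim: j => [|j IHj] le; first by exists [::]; rewrite addn0.
have [|p [xp lp sp]] := IHj; first by apply: leq_trans le; rewrite leq_add2l.
exists (rcons p (block_node (i + j).+1 u)); rewrite rcons_path last_rcons size_rcons.
rewrite xp lp addnS sp; split=> //; apply: block_step.
by rewrite -addnS.
Qed.

Let layer_connected : connected T.
Proof.
have conn_root x : connect (@adj T) root x.
  have [u /node_block->] := blk_ex x; rewrite (rootE u).
  have [|p [xp lp _]] := @block_dist 0 (lev x) u; first exact: lev_le.
  by apply/connectP; exists p; rewrite // lp.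
move=> x y; apply: connect_trans (conn_root y).
by rewrite (sym_connect_sym (@adj_sym T)).
Qed.

(** Both neighbors of a node of maximal level on a cycle would be parents of it, but parents are
    unique. *)
Let layer_acyclic : acyclic T.
Proof.
move=> p /andP[cyc up]; rewrite leqNgt; apply/negP=> sz.
have [t tp] : exists t, t \in p.
  by case: p sz {cyc up} => // t p _; exists t; apply: mem_head.
have [x xp maxx] := arg_maxnP lev tp.
have [i p' rotp] := rot_to xp.
have : cycle (@adj T) (x :: p') by rewrite -rotp rot_cycle.
have : uniq (x :: p') by rewrite -rotp rot_uniq.
have memp y : y \in x :: p' -> y \in p by rewrite -rotp mem_rot.
have: 2 < size (x :: p') by rewrite -rotp size_rot.
case: p' memp {rotp} => [//|y p']; case/lastP: p' => [//|p' z] memp _ uxy.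
rewrite /cycle rcons_path last_cons last_rcons => /andP[/= /andP[xy _] zx].
have parent_of w : w \in p -> layer_adj x w -> layer_parent w x.
  move=> /maxx le /orP[/andP[/eqP lw _]|//].
  by move: le; rewrite /= lw ltnn.
have yx : layer_parent y x.
  by apply: parent_of => //; apply: memp; rewrite in_cons mem_head orbT.
have zx' : layer_parent z x.
  apply: parent_of; last by rewrite layer_adj_sym.
  by have /memp := mem_last x (y :: rcons p' z); rewrite last_cons last_rcons.
move: uxy; rewrite (parent_unique yx zx') /= mem_rcons mem_head.
by rewrite andbF.
Qed.

Let lev_walk (x : T) p : path (@adj T) x p ->
  lev x <= lev (last x p) + size p /\ lev (last x p) <= lev x + size p.
Proof.
elim: p x => [|y p IHp] x; first by rewrite addn0.
rewrite last_cons -[size (y :: p)]/(size p).+1 => /andP[/adj_lev lxy /IHp[]].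
case: lxy => -> le1 le2; rewrite !addnS; split.
- by rewrite ltnS.
- by rewrite -addnS; apply: leq_trans le2 _; rewrite leq_add.
- exact: leq_trans (leqnSn _) (leq_trans le1 (leqnSn _)).
- by rewrite -addSn.
Qed.

Let dist_root x : @dist T root x = lev x.
Proof.
have [p [rp lp sp]] := dist_walk (layer_connected root x).
apply/eqP; rewrite eqn_leq; apply/andP; split.
  have [u xu] := blk_ex x; have [|q [rq lq <-]] := @block_dist 0 (lev x) u.
    exact: lev_le.
  have := dist_le rq; rewrite lq add0n -(node_block xu) -rootE //.
by have [_] := lev_walk rp; rewrite lp lev_root sp.
Qed.

Let leafE x : @leaf T root x = (lev x == d).
Proof.
apply/forallP/eqP => [noc|lx y]; last first.
  by rewrite /child !dist_root lx negb_and orbC neq_ltn ltnS lev_le.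
apply/eqP; rewrite eqn_leq lev_le leqNgt; apply/negP=> lt.
have [u xu] := blk_ex x; have /negP[] := noc (block_node (lev x).+1 u).
by rewrite /child !dist_root lev_block // eqxx andbT {1}(node_block xu) block_step.
Qed.

Let leaf_of (u : G) : T := block_node d u.

Let leaf_inj : injective leaf_of.
Proof.
move=> u v /(congr1 blk); rewrite !blk_block // !part_d => /setP/(_ u).
by rewrite !inE eqxx => /esym/eqP.
Qed.

Let leaf_ofP x : @leaf T root x <-> exists u, leaf_of u = x.
Proof.
rewrite leafE; split=> [/eqP lx|[u <-]]; last by rewrite lev_block.
by have [u xu] := blk_ex x; exists u; rewrite (node_block xu) lx.
Qed.

Let layer_depth (p : seq T) : path (@adj T) root p -> uniq (root :: p) ->
  @leaf T root (last root p) -> size p = d.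
Proof.
move=> rp up; rewrite leafE -dist_root.
by rewrite (uniq_path_dist layer_connected layer_acyclic rp up) => /eqP.
Qed.

(* Above level [i] an edge of the tree does not change the surrounding block
   of level [i.+1], so a walk between two such blocks descends to level [i]. *)
Let walk_low i (x : T) p u v : path (@adj T) x p -> i < d ->
  blk x \subset part i.+1 u -> blk (last x p) \subset part i.+1 v ->
  part i.+1 u != part i.+1 v -> exists2 y, y \in x :: p & lev y <= i.
Proof.
move=> xp lt sx sy nuv; elim: p x xp sx sy => [|y p IHp] x /=.
  move=> _ /subsetP sx /subsetP sy; have [w wx] := blk_ex x.
  by case/eqP: nuv; rewrite -(part_eq (sx w wx)) (part_eq (sy w wx)).
case/andP=> xy yp sx sy; have [lei|gti] := leqP (lev x) i.
  by exists x; rewrite ?mem_head.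
have [leyi|gtyi] := leqP (lev y) i.
  by exists y; rewrite // !inE eqxx orbT.
have sub : blk y \subset part i.+1 u.
  have [w [wx wy]] : exists w, w \in blk x /\ w \in blk y.
    case/orP: xy => /andP[_ /subsetP sub].
      by have [w wy] := blk_ex y; exists w; split; first exact: sub.
    by have [w wx] := blk_ex x; exists w; split; last exact: sub.
  rewrite (blkE wy); apply: subset_trans (part_mono w gtyi) _.
  by rewrite (part_eq (subsetP sx w wx)).
have [z zp lz] := IHp y yp sub sy.
by exists z; rewrite // in_cons zp orbT.
Qed.

(** Going through the common block of level [i] gives the upper bound. The lower one follows from
    [walk_low], as each edge changes the level by one. *)
Lemma leaf_dist i u v : i < d -> part i u = part i v ->
  part i.+1 u != part i.+1 v ->
  @dist T (leaf_of u) (leaf_of v) = 2 * (d - i).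
Proof.
move=> lt equv nuv; apply/eqP; rewrite eqn_leq mul2n -addnn; apply/andP; split.
  have eqx : block_node i u = block_node i v.
    by apply: node_eq; rewrite ?lev_block ?blk_block ?(ltnW lt).
  have up w : @dist T (block_node i w) (leaf_of w) <= d - i.
    have [|p [xp lp <-]] := @block_dist i (d - i) w; first by rewrite subnKC // ltnW.
    by have := dist_le xp; rewrite lp subnKC // ltnW.
  apply: leq_trans (dist_triangle (layer_connected _ (block_node i u))
                                  (layer_connected _ _)) _.
  apply: leq_add; last by rewrite eqx; exact: up.
  by rewrite dist_sym; [exact: up | exact: layer_connected].
have [p [up lp <-]] := dist_walk (layer_connected (leaf_of u) (leaf_of v)).
have [||y yp ly] := walk_low up lt _ _ nuv.
- by rewrite blk_block // part_mono.
- by rewrite lp blk_block // part_mono.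
case/splitPl: yp up lp => p1 p2 lp1; rewrite cat_path last_cat lp1 size_cat.
case/andP=> up1 yp2 lp2; apply: leq_add; rewrite leq_subLR.
  have [le _] := lev_walk up1; move: le; rewrite lp1 lev_block // => /leq_trans; apply.
  by rewrite leq_add2r.
have [_ le] := lev_walk yp2; move: le; rewrite lp2 lev_block // => /leq_trans; apply.
by rewrite leq_add2r.
Qed.

Variables (m : nat) (color : G -> 'I_m) (sig : pred ('I_m * 'I_m * nat)).
Hypothesis sig_sym : forall a b n, sig (a, b, n) = sig (b, a, n).
Hypothesis adj_sig : forall i u v, i < d -> part i u = part i v ->
  part i.+1 u != part i.+1 v -> adj u v = sig (color u, color v, 2 * (d - i)).

Lemma layered_tree_model : inhabited (tree_model m d G).
Proof.
(* Restricting [sig] to the admissible range loses nothing, since distances of distinct leaves lie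
   in it. *)
pose sig' : pred ('I_m * 'I_m * nat) :=
  fun t => sig t && (1 <= t.2 <= 2 * d).
constructor; apply: (@TreeModel m d G T root leaf_of color sig') => //.
- by move=> a b n; rewrite /sig' /= => /andP[_ ->].
- by move=> a b n; rewrite /sig' sig_sym.
move=> u v nuv.
(* The level [i] just precedes the first one at which the blocks of [u] and [v] differ. *)
have [i [lt eqi neqi]] : exists i, [/\ i < d, part i u = part i v
                                  & part i.+1 u != part i.+1 v].
  have ex : exists i, part i u != part i v.
    exists d; rewrite !part_d; apply: contraNneq nuv => /setP/(_ u).
    by rewrite !inE eqxx => /esym ->.
  case: (ex_minnP ex) => [[|i]]; first by rewrite !part0 eqxx.
  move=> neq min; exists i; split=> //.
    apply: min; rewrite !part_d; apply: contraNneq nuv => /setP/(_ u).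
    by rewrite !inE eqxx => /esym ->.
  by apply/eqP; apply: contraT => /min; rewrite ltnn.
rewrite (leaf_dist lt eqi neqi) (adj_sig lt eqi neqi) /sig' /=.
by rewrite leq_mul2l leq_subr orbT muln_gt0 subn_gt0 lt !andbT.
Qed.

End LayeredTree.

(** * Tree-models from decompositions *)

Section DecomposableTreeModel.
Variables (G : sgraph) (C : finType) (a0 : C) (d : nat).
Hypothesis decG : decomposable C d [set: G].

(** Depends only on [t] and the set [A], so all vertices of one part use the same flip. *)
Definition splitting_flip t (A : {set G}) : flip_code G C :=
  odflt ([ffun=> a0], [ffun=> false])
    [pick h | [forall x in A, decomposable C t (A :&: comp (flip_of h) x)]].

(** Passing from level [j] to level [i] uses one of the [d - j] rounds and leaves [d - i]. *)
Fixpoint flip_part i (u : G) : {set G} :=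
  if i is j.+1 then
    flip_part j u :&: comp (flip_of (splitting_flip (d - i) (flip_part j u))) u
  else [set: G].

Let part_flip i u := splitting_flip (d - i.+1) (flip_part i u).

Lemma flip_part_refl i u : u \in flip_part i u.
Proof.
by elim: i => [|i IHi]; rewrite ?in_setT //= in_setI IHi comp_refl.
Qed.

Lemma flip_part_eq i u v : v \in flip_part i u -> flip_part i v = flip_part i u.
Proof.
elim: i => //= i IHi /setIP[/IHi -> vu]; congr (_ :&: _).
apply/setP=> x; rewrite !inE; rewrite inE in vu.
by rewrite (same_connect (@connect_cflipC _ _ _ _) vu).
Qed.

Lemma flip_part_decomposable i u : i <= d -> decomposable C (d - i) (flip_part i u).
Proof.
elim: i => [|i IHi] ltid; first by rewrite subn0.
have := IHi (ltnW ltid); rewrite -(subnSK ltid) /= => /existsP[h hP].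
rewrite /splitting_flip; case: pickP => [h' /forall_inP/= | /(_ h)]; last by rewrite hP.
by apply; apply: flip_part_refl.
Qed.

Lemma flip_part_last u : flip_part d u = [set u].
Proof.
have := flip_part_decomposable u (leqnn d); rewrite subnn /= => le1.
by apply/esym/eqP; rewrite eqEcard sub1set flip_part_refl cards1.
Qed.

(** The flip relation is stored with the color at each level because parts of the same level may be
    split by different flips. *)
Definition flip_palette := {ffun 'I_d -> C * {ffun C * C -> bool}}.

Let color (u : G) : 'I_#|{: flip_palette}| :=
  enum_rank ([ffun i : 'I_d => ((part_flip i u).1 u, (part_flip i u).2)]
             : flip_palette).

(** The distance reveals the level. Conjoining the relations stored by both vertices makes the
    signature symmetric; they coincide for vertices in the same part of that level. *)
Let sig : pred ('I_#|{: flip_palette}| * 'I_#|{: flip_palette}| * nat) :=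
  fun t => let a : flip_palette := enum_val t.1.1 in
    let b : flip_palette := enum_val t.1.2 in
    [exists i : 'I_d, [&& t.2 == 2 * (d - i),
       symF (a i).2 (a i).1 (b i).1 & symF (b i).2 (a i).1 (b i).1]].

Let adj_sig i u v : i < d -> flip_part i u = flip_part i v ->
  flip_part i.+1 u != flip_part i.+1 v ->
  adj u v = sig (color u, color v, 2 * (d - i)).
Proof.
move=> lt eqi neqi; have vu : v \notin comp (flip_of (part_flip i u)) u.
  apply: contra neqi => vu; apply/eqP/esym/flip_part_eq.
  by rewrite /= inE vu andbT eqi flip_part_refl.
have ad : adj u v = symF (part_flip i u).2 ((part_flip i u).1 u) ((part_flip i u).1 v).
  exact: cflip_comp_far (comp_refl _ _) vu.
have eqf : part_flip i v = part_flip i u by rewrite /part_flip eqi.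
rewrite /sig /color /= !enum_rankK; apply/idP/existsP => [uv|[j]].
  by exists (Ordinal lt); rewrite eqxx !ffunE /= eqf -ad uv.
rewrite eqn_pmul2l // => /and3P[/eqP eqd]; rewrite !ffunE /=.
have -> : (j : nat) = i.
  by apply/eqP; rewrite eq_sym -(eqn_sub2lE (ltnW lt) (ltnW (ltn_ord j))) eqd.
by rewrite eqf -ad.
Qed.

Lemma decomposable_tree_model : inhabited (tree_model #|{: flip_palette}| d G).
Proof.
apply: (@layered_tree_model G d flip_part _ _ _ _ _ _ color sig) => //.
- exact: flip_part_refl.
- exact: flip_part_eq.
- by move=> i u; apply: subsetIl.
- exact: flip_part_last.
- move=> a b n; apply: eq_existsb => i /=; congr (_ && _).
  by rewrite andbC; congr (_ && _); apply: symFC.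
Qed.

End DecomposableTreeModel.

Theorem theorem18p17 (C : graph_class) :
  bounded_shrubdepth C <-> distance_oo_flip_flat C.
Proof.
split; first exact: shrubdepth_flip_flat.
case/flip_flat_decomposable=> k [d decC].
exists #|{: flip_palette (palette 'I_k.+1) d}|, d => G CG.
by apply: decomposable_tree_model (decC G CG); exact: (ord0, [ffun=> false], false).
Qed.
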